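(* Let $\{(x^k,y^k)\}$ be an infinite sequence generated by the Inexact Penalty Decomposition Method (defined in the context) with $\delta_k\to 0$ and $\tau_k\to\infty$. Consider the problems $$\min_x f(x)\quad\text{s.t.}\quad G(x)\in C,\ x\in D \qquad(\mathrm P)$$ and $$\min_{x,y} f(x)\quad\text{s.t.}\quad x-y=0,\ G(x)\in C,\ y\in D. \qquad (\mathrm{Q})$$ Let $(\bar x,\bar y)$ be an accumulation point of $\{(x^k,y^k)\}$ that is feasible for $(\mathrm Q)$ and AM-regular for $(\mathrm Q)$. Then $(\bar x,\bar y)$ is an M-stationary point of $(\mathrm{Q})$, and $\bar x$ is an M-stationary point of $(\mathrm P)$.
   Context: Setting: $\mathbb X,\mathbb Y$ are Euclidean spaces (real finite-dimensional Hilbert spaces), $f:\mathbb X\to\mathbb R$ and $G:\mathbb X\to\mathbb Y$ are continuously differentiable, $C\subseteq\mathbb Y$ is nonempty, closed and convex, and $D\subseteq\mathbb X$ is nonempty and closed (not necessarily convex). Product spaces carry the product inner product. Notation: $\mathrm{dist}_C(y)=\min_{z\in C}\|z-y\|$. For a nonempty closed set $S$ in a Euclidean space $\mathbb E$, $\Pi_S(x)=\operatorname{argmin}_{z\in S}\|z-x\|$ is the (set-valued) projection. The limiting normal cone of $S$ at $\bar x\in S$ is $$\mathcal N_S^{\lim}(\bar x)=\big\{w\in\mathbb E : \exists v^k\to\bar x,\ \exists w^k\to w \text{ with } w^k\in\mathrm{cone}\big(v^k-\Pi_S(v^k)\big)\ \forall k\in\mathbb N\big\},$$ where $\mathrm{cone}(A)=\{ta: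 t\ge 0,\ a\in A\}$. For convex $S$ and $\bar x\in S$, $\mathcal N_S(\bar x)=\{\lambda:\langle\lambda,x-\bar x\rangle\le 0\ \forall x\in S\}$. Both cones are defined to be $\emptyset$ if $\bar x\notin S$. $G'(x)^*$ is the adjoint of the derivative $G'(x)$. Penalty function: for $\tau>0$, $q_\tau(x,y)=f(x)+\frac{\tau}{2}\big(\|x-y\|^2+\mathrm{dist}_C^2(G(x))\big)$ for $(x,y)\in\mathbb X\times\mathbb X$; $\nabla_x q_\tau$ is its gradient with respect to $x$. Inexact Penalty Decomposition Method: choose $\delta_0\ge 0$, $\tau_0>0$ and a starting point $(x^0,y^0)\in\mathbb X\times\mathbb X$. For $k=0,1,2,\dots$ compute $(x^{k+1},y^{k+1})$ such that $$\|\nabla_x q_{\tau_k}(x^{k+1},y^{k+1})\|\le\delta_k\quad\text{and}\quad y^{k+1}\in\operatorname{argmin}_{y\in D} q_{\tau_k}(x^{k+1},y),$$ and then choose $\delta_{k+1}\le\delta_k$ (with $\delta_{k+1}\ge0$) and $\tau_{k+1}>\tau_k$. Stationarity and regularity (general): consider a problem $\min_w\varphi(w)$ s.t. $H(w)\in K$, $w\in S$, with $\varphi,H$ continuously differentiable maps between Euclidean spaces, $K$ nonempty closed convex, $S$ nonempty closed, and let $\bar w$ be feasible. - $\bar w$ is M-stationary if there is a multiplier $\lambda\in\mathcal N_K(H(\bar w))$ with $0\in\nabla\varphi(\bar w)+H'(\bar w)^*\lambda+\mathcal N_S^{\lim}(\bar w)$. - Put $\mathcal M(w,z)=H'(w)^*\mathcal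 N_K(H(w)-z)+\mathcal N_S^{\lim}(w)$. Then $\bar w$ is AM-regular if $\limsup_{w\to\bar w,z\to0}\mathcal M(w,z)\subseteq\mathcal M(\bar w,0)$, where the left-hand side is the set of all $v$ for which there exist $w^k\to\bar w$ with $w^k\in S$, $z^k\to 0$ and $v^k\to v$ with $v^k\in\mathcal M(w^k,z^k)$ for all $k\in\mathbb N$. Problem $(\mathrm P)$ is of this form with $w=x$, $\varphi=f$, $H=G$, $K=C$, $S=D$. Problem $(\mathrm Q)$ is regarded as such a problem with $w=(x,y)\in\mathbb X\times\mathbb X$, $\varphi(x,y)=f(x)$, $H(x,y)=(G(x),x-y)$, $K=C\times\{0\}$, $S=\mathbb X\times D$. *)

(* Defs.v *)
From HB Require Import structures.
From mathcomp Require Import all_boot all_order all_algebra.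
From mathcomp Require Import all_classical all_reals.
From mathcomp Require Import topology normedtype sequences derive.
From mathcomp Require Import lra.

Set Implicit Arguments.
Unset Strict Implicit.
Unset Printing Implicit Defensive.

Import Order.TTheory GRing.Theory Num.Theory.
Import numFieldNormedType.Exports.

Local Open Scope classical_set_scope.
Local Open Scope ring_scope.

(* A finite-dimensional normed space whose norm, and hence whose topology, is
   the one induced by an inner product. *)
HB.mixin Record isEuclidean (R : realType) E
    of NormedModule R E & Vector R E := {
  dotp : E -> E -> R;
  dotpC : forall x y, dotp x y = dotp y x;
  dotp_linearl : forall a x y z,
    dotp (a *: x + y) z = a * dotp x z + dotp y z;
  dotpxx : forall x, dotp x x = `|x| ^+ 2 }.

#[short(type="euclideanType")]
HB.structure Definition Euclidean (R : realType) :=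
  { E of isEuclidean R E & NormedModule R E & Vector R E }.

(* The library norms the type [E * F] by the maximum of the two norms.  The
   Euclidean product is therefore put on an alias of [E * F]. *)
Definition eprod (R : realType) (E F : euclideanType R) : Type := (E * F)%type.

Section EuclideanProduct.
Context {R : realType} {E F : euclideanType R}.
Implicit Types x y z : eprod E F.

HB.instance Definition _ := Vector.copy (eprod E F) (E * F)%type.

Definition eprod_norm x : R := Num.sqrt (`|x.1| ^+ 2 + `|x.2| ^+ 2).

Let sqr_eprod_norm x : eprod_norm x ^+ 2 = `|x.1| ^+ 2 + `|x.2| ^+ 2.
Proof. by rewrite sqr_sqrtr// addr_ge0 ?sqr_ge0. Qed.

Let eprod_normD x y : eprod_norm (x + y) <= eprod_norm x + eprod_norm y.
Proof.
have n0 z : 0 <= eprod_norm z by exact: sqrtr_ge0.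
rewrite -(@ler_pXn2r _ 2)// ?nnegrE ?addr_ge0//.
rewrite sqr_eprod_norm.
have h1 : `|x.1 + y.1| ^+ 2 <= (`|x.1| + `|y.1|) ^+ 2.
  by rewrite ler_pXn2r// ?nnegrE ?addr_ge0// ler_normD.
have h2 : `|x.2 + y.2| ^+ 2 <= (`|x.2| + `|y.2|) ^+ 2.
  by rewrite ler_pXn2r// ?nnegrE ?addr_ge0// ler_normD.
have h3 : `|x.1| * `|y.1| + `|x.2| * `|y.2| <= eprod_norm x * eprod_norm y.
  rewrite -(@ler_pXn2r _ 2)// ?nnegrE ?addr_ge0 ?mulr_ge0//.
  rewrite exprMn !sqr_eprod_norm.
  have := sqr_ge0 (`|x.1| * `|y.2| - `|x.2| * `|y.1|).
  by nra.
have := sqr_eprod_norm x; have := sqr_eprod_norm y.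
rewrite [(x + y).1]/= [(x + y).2]/=.
by nra.
Qed.

Let eprod_normZ (a : R) x : eprod_norm (a *: x) = `|a| * eprod_norm x.
Proof.
rewrite /eprod_norm /= !normrZ !exprMn -mulrDr sqrtrM ?sqr_ge0//.
by rewrite sqrtr_sqr normr_id.
Qed.

Let eprod_norm0 x : eprod_norm x = 0 -> x = 0.
Proof.
move=> /eqP; rewrite sqrtr_eq0 => h.
have := le_anti (introT andP (conj h (addr_ge0 (sqr_ge0 _) (sqr_ge0 _)))).
move=> /eqP; rewrite paddr_eq0 ?sqr_ge0// !sqrf_eq0 !normr_eq0.
by case: x {h} => x1 x2 /= /andP[/eqP-> /eqP->].
Qed.

HB.instance Definition _ := Lmodule_isNormed.Build R (eprod E F)
  eprod_normD eprod_normZ eprod_norm0.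

Definition eprod_dotp x y : R := dotp x.1 y.1 + dotp x.2 y.2.

Let eprod_dotpC x y : eprod_dotp x y = eprod_dotp y x.
Proof. by congr (_ + _); exact: dotpC. Qed.

Let eprod_dotp_linearl a x y z :
  eprod_dotp (a *: x + y) z = a * eprod_dotp x z + eprod_dotp y z.
Proof. by rewrite /eprod_dotp /= !dotp_linearl mulrDr addrACA. Qed.

Let eprod_dotpxx x : eprod_dotp x x = `|x| ^+ 2.
Proof. by rewrite [RHS]sqr_eprod_norm /eprod_dotp !dotpxx. Qed.

HB.instance Definition _ := isEuclidean.Build R (eprod E F)
  eprod_dotpC eprod_dotp_linearl eprod_dotpxx.

End EuclideanProduct.

Section Calculus.
Context {R : realType}.

(* Continuity of the derivative is with respect to the operator norm. *)
Definition continuously_differentiable (E F : normedModType R) (f : E -> F) :=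
  (forall x, differentiable f x) /\
  (forall x (e : R), 0 < e ->
     \forall y \near x, forall h, `|'d f y h - 'd f x h| <= e * `|h|).

(* By the Riesz representation theorem the sets in the next two definitions are
   singletons as soon as [L] is linear, resp. [f] is differentiable at [x]. *)
Definition adjoint (E F : euclideanType R) (L : E -> F) (l : F) : E :=
  get [set u | forall h, dotp u h = dotp l (L h)].

Definition gradient (E : euclideanType R) (f : E -> R) (x : E) : E :=
  get [set g | forall h, dotp g h = 'd f x h].

End Calculus.

Section VariationalAnalysis.
Context {R : realType}.
Implicit Types E F : euclideanType R.

(* A minimum when [S] is nonempty and closed. *)
Definition dist_to E (S : set E) (y : E) : R := inf [set `|z - y| | z in S].

Definition argmin (T : Type) (S : set T) (g : T -> R) : set T :=
  [set x | S x /\ forall z, S z -> g x <= g z].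

Definition projection E (S : set E) (x : E) : set E :=
  argmin S (fun z => `|z - x|).

Definition cone E (A : set E) : set E :=
  [set w | exists t a, [/\ 0 <= t :> R, A a & w = t *: a]].

(* Both normal cones below are empty at points outside [S]. *)
Definition limiting_normal_cone E (S : set E) (x : E) : set E :=
  [set w | S x /\ exists v_ w_ : nat -> E,
    [/\ v_ @ \oo --> x, w_ @ \oo --> w
      & forall k, cone [set v_ k - p | p in projection S (v_ k)] (w_ k)]].

Definition normal_cone E (S : set E) (x : E) : set E :=
  [set l | S x /\ forall z, S z -> dotp l (z - x) <= 0].

End VariationalAnalysis.

(* Minimize [objective w] subject to [constraint_set (constraint w)] and
   [abstract_set w]. *)
Record problem (R : realType) (E F : euclideanType R) := Problem {
  objective : E -> R;
  constraint : E -> F;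
  constraint_set : set F;
  abstract_set : set E }.

Section Problems.
Context {R : realType} {E F : euclideanType R}.
Variable P : problem E F.
Local Notation phi := (objective P).
Local Notation H := (constraint P).
Local Notation K := (constraint_set P).
Local Notation S := (abstract_set P).

Definition feasible (w : E) : Prop := K (H w) /\ S w.

Definition M_stationary (w : E) : Prop :=
  exists2 l, normal_cone K (H w) l &
  exists2 v, limiting_normal_cone S w v &
    0 = gradient phi w + adjoint ('d H w) l + v.

Definition regularity_map (w : E) (z : F) : set E :=
  [set adjoint ('d H w) l + v | l in normal_cone K (H w - z)
                              & v in limiting_normal_cone S w].

Definition AM_regular (w : E) : Prop :=
  forall v : E,
    (exists (w_ : nat -> E) (z_ : nat -> F) (v_ : nat -> E),
      [/\ w_ @ \oo --> w, forall k, S (w_ k), z_ @ \oo --> (0 : F),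
          v_ @ \oo --> v & forall k, regularity_map (w_ k) (z_ k) (v_ k)]) ->
    regularity_map w 0 v.

End Problems.

Section PenaltyDecomposition.
Context {R : realType} {X Y : euclideanType R}.
Variables (f : X -> R) (G : X -> Y) (C : set Y) (D : set X).

Definition problemP : problem X Y := Problem f G C D.

Definition problemQ : problem (eprod X X) (eprod Y X) :=
  @Problem R (eprod X X) (eprod Y X)
    (fun w => f w.1) (fun w => (G w.1, w.1 - w.2))
    (C `*` [set 0]) ([set: X] `*` D).

Definition penalty (tau : R) (x y : X) : R :=
  f x + tau / 2 * (`|x - y| ^+ 2 + dist_to C (G x) ^+ 2).

Definition penalty_decomposition_sequence
    (delta tau : nat -> R) (x y : nat -> X) : Prop :=
  [/\ 0 <= delta 0%N, 0 < tau 0%N &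
   forall k,
    [/\ `|gradient (fun u => penalty (tau k) u (y k.+1)) (x k.+1)| <= delta k,
        argmin D (penalty (tau k) (x k.+1)) (y k.+1),
        0 <= delta k.+1 <= delta k
      & tau k < tau k.+1]].

End PenaltyDecomposition.

(* Main.v *)
Require Import Defs.
From mathcomp Require Import all_boot all_order all_algebra.
From mathcomp Require Import all_classical all_reals.
From mathcomp Require Import topology normedtype sequences landau derive convex.
From mathcomp Require Import interval_inference.
From mathcomp Require Import ring lra.
From HB Require Import structures.
Import Order.TTheory GRing.Theory Num.Theory.
Import numFieldNormedType.Exports.
Local Open Scope classical_set_scope.
Local Open Scope ring_scope.
Set Implicit Arguments.
Unset Strict Implicit.
Unset Printing Implicit Defensive.

(** At an iterate [(x, y)] with penalty parameter [tau], let [p] be the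
    projection of [G x] onto [C]. The squared distance to a convex set is
    differentiable, so the gradient of the penalty function in [x] is
      [gradient f x + tau (x - y) + (G' x)^* (tau (G x - p))],
    and minimality of [y] says exactly that [y] is a projection of [x] onto
    [D]. Hence [tau (G x - p)] is normal to [C] at [p], and [tau (x - y)] is
    a limiting normal to [D] at [y]. Take [(tau (G x - p), tau (x - y))] as
    multiplier in the split problem, whose derivative has adjoint
      [(l, m) |-> ((G' x)^* l + m, - m)],
    and [(0, tau (x - y))] as normal to [X * D]: the second components cancel,
    and the first component of the sum is the gradient of the penalty function
    minus [gradient f x]. This sum lies in the regularity set at [(x, y)] for
    the shift [(G x - p, x - y)] ([regularity_map_penalty]).

    Along iterates that converge to [(xbar, ybar)] the gradient of the
    penalty tends to [0] because it is bounded by [delta], and the shifts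
    tend to [0] because the limit is feasible. AM-regularity therefore puts
    [(- gradient f xbar, 0)] in the unshifted set, which is M-stationarity
    for the split problem. The multiplier of [x - y = 0] is then forced to
    be a limiting normal to [D]; eliminating it gives M-stationarity for the
    original problem ([M_stationary_problemQ]).

    The analysis behind this rests on the Riesz representation theorem: it
    provides adjoints and gradients, and it makes coordinates, hence all
    linear maps, continuous. Compactness of balls, and with it the existence
    of projections, follows from the case of row vectors. *)

(** * Inner products and the Riesz representation *)

Section InnerProduct.
Context {R : realType} {E : euclideanType R}.
Implicit Types (x y z u v : E) (a : R).

Lemma dotpDl x y z : dotp (x + y) z = dotp x z + dotp y z.
Proof. by rewrite -[x]scale1r dotp_linearl mul1r !scale1r. Qed.

Lemma dotp0l z : dotp 0 z = 0.
Proof. by apply: (addrI (dotp 0 z)); rewrite -dotpDl !addr0. Qed.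

Lemma dotpZl a x z : dotp (a *: x) z = a * dotp x z.
Proof. by rewrite -[a *: x]addr0 dotp_linearl dotp0l addr0. Qed.

Lemma dotpNl x z : dotp (- x) z = - dotp x z.
Proof. by rewrite -scaleN1r dotpZl mulN1r. Qed.

Lemma dotpBl x y z : dotp (x - y) z = dotp x z - dotp y z.
Proof. by rewrite dotpDl dotpNl. Qed.

Lemma dotpDr x y z : dotp z (x + y) = dotp z x + dotp z y.
Proof. by rewrite dotpC dotpDl !(dotpC _ z). Qed.

Lemma dotp0r z : dotp z 0 = 0.
Proof. by rewrite dotpC dotp0l. Qed.

Lemma dotpZr a x z : dotp z (a *: x) = a * dotp z x.
Proof. by rewrite dotpC dotpZl dotpC. Qed.

Lemma dotpNr x z : dotp z (- x) = - dotp z x.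
Proof. by rewrite dotpC dotpNl dotpC. Qed.

Lemma dotpBr x y z : dotp z (x - y) = dotp z x - dotp z y.
Proof. by rewrite dotpDr dotpNr. Qed.

Lemma dotp_sumr z (I : Type) (r : seq I) (F : I -> E) :
  dotp z (\sum_(i <- r) F i) = \sum_(i <- r) dotp z (F i).
Proof. by elim/big_rec2: _ => [|i a b _ <-]; rewrite ?dotp0r ?dotpDr. Qed.

Lemma sqr_normD x y : `|x + y| ^+ 2 = `|x| ^+ 2 + 2 * dotp x y + `|y| ^+ 2.
Proof. by rewrite -!dotpxx dotpDl !dotpDr (dotpC y x); ring. Qed.

Lemma sqr_normB x y : `|x - y| ^+ 2 = `|x| ^+ 2 - 2 * dotp x y + `|y| ^+ 2.
Proof. by rewrite sqr_normD dotpNr normrN; ring. Qed.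

Lemma dotp_le x y : dotp x y <= `|x| * `|y|.
Proof.
have [->|x0] := eqVneq x 0; first by rewrite dotp0l normr0 mul0r.
have [->|y0] := eqVneq y 0; first by rewrite dotp0r normr0 mulr0.
have xy0 : 0 < `|x| * `|y| by rewrite mulr_gt0 ?normr_gt0.
have := sqr_ge0 `| `|y| *: x - `|x| *: y|.
rewrite sqr_normB dotpZl dotpZr !normrZ !normr_id !exprMn.
move: xy0; nra.
Qed.

Lemma normr_dotp_le x y : `|dotp x y| <= `|x| * `|y|.
Proof.
rewrite ler_norml dotp_le andbT lerNl -dotpNl.
by rewrite -[`|x|]normrN; exact: dotp_le.
Qed.

Lemma eq_dotp u v : (forall h, dotp u h = dotp v h) -> u = v.
Proof.
move=> uv; apply/eqP; rewrite -subr_eq0 -normr_eq0 -sqrf_eq0 -dotpxx.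
by rewrite dotpBl uv subrr.
Qed.

(** The dual of the basis [b]: the map [u |-> \sum_j <u, b_j> b_j] has trivial
    kernel, hence is onto in finite dimension, and any vector that it sends to
    [\sum_j L b_j *: b_j] represents [L]. *)
Theorem riesz_representation (L : E -> R) :
  (forall a x y, L (a *: x + y) = a * L x + L y) ->
  exists u, forall h, dotp u h = L h.
Proof.
move=> linL; pose b := vbasis (fullv : {vspace E}).
have bP : basis_of fullv b by exact: vbasisP.
have L0 : L 0 = 0.
  by have := linL 1 0 0; rewrite scaler0 addr0 mul1r; lra.
have LZ a x : L (a *: x) = a * L x by rewrite -[_ *: x]addr0 linL L0 addr0.
have LD x y : L (x + y) = L x + L y by rewrite -[x]scale1r linL mul1r !scale1r.
pose T u : E := \sum_(j < \dim {: E}) dotp u b`_j *: b`_j.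
have linT : linear T.
  move=> a u v; rewrite /T scaler_sumr -big_split/=; apply: eq_bigr => j _.
  by rewrite dotp_linearl scalerDl scalerA.
pose T' : {linear E -> E} := HB.pack T (GRing.isLinear.Build _ _ _ _ T linT).
have ext u (h : E) :
    (forall j : 'I_(\dim {: E}), dotp u b`_j = L b`_j) -> dotp u h = L h.
  move=> ub; rewrite (coord_basis bP (memvf h)) dotp_sumr.
  rewrite (big_morph L LD L0); apply: eq_bigr => j _.
  by rewrite dotpZr LZ ub.
have free_b (c d : 'I_(\dim {: E}) -> R) :
    \sum_(j < \dim {: E}) c j *: b`_j = \sum_j d j *: b`_j -> c =1 d.
  move=> /(congr1 (fun v => (coord b)^~ v)) cd j.
  move/(congr1 (fun k => k j)): cd.
  by rewrite !coord_sum_free// (basis_free bP).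
have kerT : lker (linfun T') == 0%VS.
  apply/lker0P => u v; rewrite !lfunE /= => /free_b uv.
  apply: eq_dotp => h; rewrite (coord_basis bP (memvf h)) !dotp_sumr.
  by apply: eq_bigr => j _; rewrite !dotpZr uv.
pose t : E := \sum_(j < \dim {: E}) L b`_j *: b`_j.
exists ((linfun T')^-1%VF t) => h; apply: ext; apply: free_b.
by rewrite -[RHS](lker0_lfunVK kerT t) [RHS]lfunE.
Qed.

End InnerProduct.

(** * Linear maps, adjoints and gradients *)

Section LinearMaps.
Context {R : realType}.
Implicit Types E F : euclideanType R.

Lemma coord_bounded E n (b : n.-tuple E) (j : 'I_n) :
  exists k, 0 <= k /\ forall h, `|coord b j h| <= k * `|h|.
Proof.
have [u uP] := @riesz_representation R E (coord b j) (linearP _).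
by exists `|u|; split=> // h; rewrite -uP normr_dotp_le.
Qed.

(** A linear map is a combination of vectors with the coordinates as
    coefficients, and these are bounded. *)
Lemma linear_continuous E (V : normedModType R) (L : {linear E -> V}) :
  continuous L.
Proof.
pose b := vbasis (fullv : {vspace E}).
have bP : basis_of fullv b by exact: vbasisP.
have {}/choice[k kP] := coord_bounded b.
apply: bounded_linear_continuous; apply/bounded_funP => r.
exists (\sum_(j < \dim {: E}) `|k j| * `|r| * `|L b`_j|) => x xr.
rewrite (coord_basis bP (memvf x)) linear_sum.
apply: (le_trans (ler_norm_sum _ _ _)); apply: ler_sum => j _.
rewrite linearZ normrZ ler_wpM2r//.
apply: (le_trans ((kP j).2 x)); rewrite (le_trans (ler_norm _))// normrM.
rewrite ler_wpM2l//.
by rewrite normr_id (le_trans xr)// ler_norm.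
Qed.

Lemma adjointP E F (L : {linear E -> F}) l h :
  dotp (adjoint L l) h = dotp l (L h).
Proof.
move: h; apply: (@getPex _ [set u : E | forall h, dotp u h = dotp l (L h)]).
by apply: riesz_representation => a x y; rewrite linearP dotpDr dotpZr.
Qed.

Lemma gradientP E (f : E -> R) x h : dotp (gradient f x) h = 'd f x h.
Proof.
move: h; apply: (@getPex _ [set u : E | forall h, dotp u h = 'd f x h]).
by apply: riesz_representation => a y z; rewrite linearP.
Qed.

End LinearMaps.

(** * Differentials characterized by remainders *)

Section Differential.
Context {R : realType}.
Implicit Types E : euclideanType R.

Lemma diff_remainder (V W : normedModType R) (f : V -> W) x (e : R) :
  differentiable f x -> 0 < e ->
  \forall h \near 0, `|f (x + h) - f x - 'd f x h| <= e * `|h|.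
Proof.
move=> df e0; have := diff_locallyxC df.
move=> dfx; near=> h.
rewrite dfx -addrA -opprD [X in X - _]addrC addrK.
by near: h; apply: littleoP.
Unshelve. all: by end_near. Qed.

(** Only the remainder has to be estimated: the linear map [L] is continuous
    because its domain is Euclidean. *)
Lemma diff_of_remainder E (W : normedModType R) (f L : E -> W) x :
  linear L ->
  (forall e : R, 0 < e ->
     \forall h \near 0, `|f (x + h) - f x - L h| <= e * `|h|) ->
  differentiable f x /\ 'd f x = L :> (E -> W).
Proof.
move=> linL fL.
pose L' : {linear E -> W} := HB.pack L (GRing.isLinear.Build _ _ _ _ L linL).
have cL : continuous L' by exact: linear_continuous.
have fo : f \o shift x = cst (f x) + L' +o_ 0 id.
  apply/eqaddoP => e e0; near=> h.
  rewrite /= !fctE /= opprD addrA (addrC h x).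
  by near: h; exact: fL.
have dL : 'd f x = L' :> (E -> W) by exact: diff_unique.
by split=> //; apply/diff_locallyP; rewrite dL.
Unshelve. all: by end_near. Qed.

End Differential.

(** * Projections onto closed and onto convex sets *)

Section Projection.
Context {R : realType} {E : euclideanType R}.
Implicit Types (S C : set E) (x y z p : E).

(** A ball has bounded coordinates, so it lies in the continuous image of a cube
    of row vectors. *)
Lemma compact_superset_ball (r : R) :
  exists2 K : set E, compact K & forall x, `|x| <= r -> K x.
Proof.
pose b := vbasis (fullv : {vspace E}).
have bP : basis_of fullv b by exact: vbasisP.
have {}/choice[k kP] := coord_bounded b.
pose n : nat := \dim (fullv : {vspace E}).
pose A (j : 'I_n) : set R := `[- (k j * r), k j * r]%classic.
pose phi (c : 'rV[R]_n) : E := \sum_(j < n) c 0 j *: b`_j.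
exists (phi @` [set c : 'rV[R]_n | forall j, A j (c ord0 j)]).
  apply: continuous_compact.
    apply: continuous_subspaceT; apply: continuous_big.
      by move=> v; exact: add_continuous.
    move=> j _ c.
    by apply: cvgZr_tmp; [exact: (nbhs_filter c)|exact: coord_continuous].
  by apply: rV_compact => j; exact: segment_compact.
move=> x xr; exists (\row_j coord b j x); last first.
  rewrite /phi [RHS](coord_basis bP (memvf x)).
  by apply: eq_bigr => j _; rewrite mxE.
move=> j; rewrite mxE /A/= in_itv/= -ler_norml.
by rewrite (le_trans ((kP j).2 x))// ler_wpM2l// (kP j).1.
Qed.

(** The distance to [x] has the same minimizers on [S] as on the points of [S]
    in a ball that contains a given [s] of [S], and those form a compact set. *)
Lemma projection_nonempty S x : closed S -> S !=set0 -> projection S x !=set0.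
Proof.
move=> cS [s Ss]; have [K cK ballK] := compact_superset_ball (`|s - x| + `|x|).
have Ks : K s.
  by apply: ballK; rewrite -[in leLHS](subrK x s) ler_normD.
have dC : continuous (fun z : E => `|z - x|).
  move=> z; apply: cvg_norm; apply: cvgB; [exact: cvg_id|exact: cvg_cst].
have [] := @compact_EVT_min _ _ (fun z : E => `|z - x|) (K `&` S).
- by exists s.
- exact: compact_closedI.
- exact: continuous_subspaceT.
move=> p /set_mem[_ Sp] pmin; exists p; split=> // z Sz.
have [zs|sz] := leP (`|z - x|) (`|s - x|).
  apply: pmin; apply/mem_set; split=> //; apply: ballK.
  by rewrite -[in leLHS](subrK x z) (le_trans (ler_normD _ _))// lerD2r.
by apply: (le_trans (pmin s _) (ltW sz)); apply/mem_set.
Qed.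

Lemma dist_toE S x p : projection S x p -> dist_to S x = `|p - x|.
Proof.
move=> [Sp pmin]; apply/eqP; rewrite eq_le; apply/andP; split.
  apply: ge_inf; last by exists p.
  by exists 0 => _ [z _ <-].
apply: lb_le_inf; first by exists `|p - x|, p.
by move=> _ [z Sz <-]; exact: pmin.
Qed.

(** Moving from [p] towards [z] stays in [C], and would get closer to [y] if the
    angle at [p] were acute. *)
Lemma projection_variational_ineq C y p z :
  convex_set C -> projection C y p -> C z -> dotp (y - p) (z - p) <= 0.
Proof.
move=> cC [Cp pmin] Cz; rewrite leNgt; apply/negP => a0.
set a := dotp _ _ in a0; pose N := `|z - p| ^+ 2.
have N0 : 0 <= N by exact: sqr_ge0.
have aN : 0 < a + N by rewrite ltr_wpDr.
(* The squared distance to [y] changes by [- 2 t a + t ^+ 2 N], and this step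
   makes it negative while staying below [1]. *)
pose t : R := a / (a + N).
have t0 : 0 < t by rewrite divr_gt0.
have t1 : t <= 1 by rewrite ler_pdivrMr// mul1r lerDl.
have tN : t * N <= a.
  by rewrite /t mulrAC ler_pdivrMr// (ler_wpM2l (ltW a0))// lerDr ltW.
have Cq : C (p + t *: (z - p)).
  have := cC z p (Itv01 (ltW t0) t1) (mem_set Cz) (mem_set Cp).
  rewrite scalerBr addrCA -[X in _ + (X - _)]scale1r -scalerBl.
  by move=> /set_mem.
have := pmin _ Cq; rewrite -(@ler_pXn2r _ 2)// ?nnegrE//.
rewrite addrAC [leRHS]sqr_normD dotpZr normrZ exprMn (gtr0_norm t0).
rewrite -(opprB y p) dotpNl -/a -/N.
by move: tN t0 a0; clear; nra.
Qed.

(** The upper estimate bounds the distance of [y + h] to [C] by its distance to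
    [p]. The lower one bounds the distance of [y] by its distance to the
    projection [q] of [y + h], and uses [dotp (q - p) h <= `|h| ^+ 2], which holds
    because the projection is firmly nonexpansive. *)
Lemma sqr_dist_to_remainder C y p h : closed C -> convex_set C ->
  projection C y p ->
  `|dist_to C (y + h) ^+ 2 - dist_to C y ^+ 2 - 2 * dotp (y - p) h|
    <= `|h| ^+ 2.
Proof.
move=> clC cC pP; have Cp := pP.1.
have [q qP] := @projection_nonempty C (y + h) clC (ex_intro _ p Cp).
have Cq := qP.1; rewrite (dist_toE pP) (dist_toE qP).
have le1 : `|q - (y + h)| ^+ 2 <= `|p - (y + h)| ^+ 2.
  by rewrite ler_pXn2r ?nnegrE//; exact: qP.2.
have le2 : `|p - y| ^+ 2 <= `|q - y| ^+ 2.
  by rewrite ler_pXn2r ?nnegrE//; exact: pP.2.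
have v1 := projection_variational_ineq cC pP Cq.
have v2 := projection_variational_ineq cC qP Cp.
have n0 := sqr_ge0 `|(q - p) - h|.
move: le1 le2 v1 v2 n0.
rewrite -!dotpxx !(dotpDl, dotpDr, dotpNl, dotpNr, dotpBl, dotpBr).
rewrite (dotpC h q) (dotpC h p) (dotpC h y) (dotpC q p) (dotpC y q) (dotpC y p).
move=> le1 le2 v1 v2 n0.
by rewrite ler_norml; apply/andP; split; lra.
Qed.

Lemma normal_cone_projection C y p (t : R) : convex_set C -> 0 <= t ->
  projection C y p -> normal_cone C p (t *: (y - p)).
Proof.
move=> cC t0 pP; split; first exact: pP.1.
move=> z Cz; rewrite dotpZl mulr_ge0_le0//.
exact: projection_variational_ineq cC pP Cz.
Qed.

End Projection.

(** * The gradient of the penalty function *)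

Section PenaltyGradient.
Context {R : realType}.
Implicit Types E X Y : euclideanType R.

(** The differential described by its values, so that it can be computed along
    sums, multiples and compositions without exhibiting linear maps. *)
Definition has_diff (V W : normedModType R) (f : V -> W) x (L : V -> W) :=
  differentiable f x /\ forall h, 'd f x h = L h.

Lemma has_diffD (V : normedModType R) (f g L M : V -> R) x :
  has_diff f x L -> has_diff g x M ->
  has_diff (fun u => f u + g u) x (fun h => L h + M h).
Proof.
move=> [df fL] [dg gM].
split; first exact: differentiableD.
move=> h; rewrite -fL -gM.
have E := diffD df dg.
exact (congr1 (fun F => F h) E).
Qed.

Lemma has_diffMl (V : normedModType R) (k : R) (f L : V -> R) x :
  has_diff f x L -> has_diff (fun u => k * f u) x (fun h => k * L h).
Proof.
move=> [df fL].
split; first exact: (differentiableZ k df).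
move=> h; rewrite -fL.
have E := diffZ k df.
exact (congr1 (fun F => F h) E).
Qed.

Lemma has_diff_comp (V W : normedModType R) (g : V -> W) (f : W -> R) M L x :
  has_diff g x M -> has_diff f (g x) L ->
  has_diff (fun u => f (g u)) x (fun h => L (M h)).
Proof.
move=> [dg gM] [df fL].
split; first exact: differentiable_comp dg df.
move=> h; rewrite -gM -fL.
have E := diff_comp dg df.
exact (congr1 (fun F => F h) E).
Qed.

Lemma has_diff_quadratic_remainder E (g : E -> R) (x u : E) :
  (forall h, `|g (x + h) - g x - 2 * dotp u h| <= `|h| ^+ 2) ->
  has_diff g x (fun h => 2 * dotp u h).
Proof.
move=> gu; have [|e e0|dg dE] :=
    @diff_of_remainder R E R g (fun h => 2 * dotp u h) x.
- by move=> a v w; rewrite dotpDr dotpZr mulrDr mulrCA.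
- near=> h; apply: (le_trans (gu h)).
  by rewrite expr2 ler_wpM2r.
- by split=> // h; rewrite dE.
Unshelve. all: by end_near. Qed.

Lemma gradient_penalty X Y (f : X -> R) (G : X -> Y) (C : set Y) tau x y p :
  differentiable f x -> differentiable G x -> closed C -> convex_set C ->
  projection C (G x) p ->
  gradient (fun u => penalty f G C tau u y) x =
    gradient f x + tau *: (x - y) + adjoint ('d G x) (tau *: (G x - p)).
Proof.
move=> df dG clC cC pP.
have dA : has_diff (fun u => `|u - y| ^+ 2 : R) x (fun h => 2 * dotp (x - y) h).
  apply: has_diff_quadratic_remainder => h.
  rewrite (addrAC x h) (sqr_normD (x - y)).
  rewrite [X in `|X| <= _](_ : _ = `|h| ^+ 2); last by ring.
  by rewrite ger0_norm// sqr_ge0.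
have dB := has_diff_quadratic_remainder (g := fun z => dist_to C z ^+ 2)
  (fun h => sqr_dist_to_remainder h clC cC pP).
have dBG := has_diff_comp (conj dG (fun=> erefl)) dB.
have [_ dE] := has_diffD (conj df (fun=> erefl))
  (has_diffMl (tau / 2) (has_diffD dA dBG)).
apply: eq_dotp => h; rewrite gradientP [LHS]dE [in RHS]dotpDl [in RHS]dotpDl.
by rewrite adjointP gradientP !dotpZl; field.
Qed.

End PenaltyGradient.

(** * Euclidean products *)

Section EuclideanProduct.
Context {R : realType} {E F : euclideanType R}.
Implicit Types w : eprod E F.

Lemma norm_fst_le w : `|w.1| <= `|w|.
Proof.
rewrite -(@ler_pXn2r _ 2)// ?nnegrE//.
by rewrite -!dotpxx [leRHS]/(eprod_dotp w w) /eprod_dotp !dotpxx lerDl sqr_ge0.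
Qed.

Lemma norm_snd_le w : `|w.2| <= `|w|.
Proof.
rewrite -(@ler_pXn2r _ 2)// ?nnegrE//.
by rewrite -!dotpxx [leRHS]/(eprod_dotp w w) /eprod_dotp !dotpxx lerDr sqr_ge0.
Qed.

Lemma norm_eprod_le w : `|w| <= `|w.1| + `|w.2|.
Proof.
rewrite -(@ler_pXn2r _ 2)// ?nnegrE ?addr_ge0//.
rewrite -!dotpxx [leLHS]/(eprod_dotp w w) /eprod_dotp !dotpxx.
by rewrite sqrrD -addrA lerD2l lerDr mulrn_wge0// mulr_ge0.
Qed.

Lemma eprod_cvgP (T : Type) (Fi : set_system T) (FF : Filter Fi)
    (v : T -> eprod E F) w :
  v @ Fi --> w <->
  (fun k => (v k).1) @ Fi --> w.1 /\ (fun k => (v k).2) @ Fi --> w.2.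
Proof.
split=> [vw|[v1 v2]].
  split; apply/cvgrPdist_le => e e0;
    move/cvgrPdist_le : vw => /(_ _ e0); apply: filterS => k; apply: le_trans.
    exact: (norm_fst_le (w - v k)).
  exact: (norm_snd_le (w - v k)).
apply/cvgrPdist_le => e e0; have e20 : 0 < e / 2 by rewrite divr_gt0.
move/cvgrPdist_le : v1 => /(_ _ e20); move/cvgrPdist_le : v2 => /(_ _ e20).
apply: filterS2 => k k2 k1; apply: (le_trans (norm_eprod_le _)).
by rewrite (splitr e) lerD.
Qed.

Lemma near0_fst (P : E -> Prop) :
  (\forall h \near 0, P h) -> \forall h \near (0 : eprod E F), P h.1.
Proof.
have /eprod_cvgP[c _] : (id : eprod E F -> eprod E F) @ 0 --> 0.
  exact: cvg_id.
exact: c.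
Qed.

End EuclideanProduct.

(** * Normal cones of products and at projections *)

Section NormalCones.
Context {R : realType}.
Implicit Types E X Y : euclideanType R.

Lemma normal_cone_setX0 X Y (C : set Y) (c : Y) (l : eprod Y X) :
  normal_cone (C `*` [set 0] : set (eprod Y X)) (c, 0) l <->
  normal_cone C c l.1.
Proof.
have dotE (z : eprod Y X) : z.2 = 0 -> dotp l (z - (c, 0)) = dotp l.1 (z.1 - c).
  move=> z0; rewrite [LHS]/(eprod_dotp _ _) /eprod_dotp /=.
  by rewrite z0 subrr dotp0r addr0.
split=> [[[Cc _] lP]|[Cc lP]].
  split=> // z Cz; have := lP (z, 0) (conj Cz erefl).
  by rewrite dotE.
by split=> // z [Cz z0]; rewrite dotE//; exact: lP.
Qed.

(** The squared distance is the sum over the two components, and the free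
    component can make its own term vanish. *)
Lemma projection_setTX X (D : set X) (v p : eprod X X) :
  projection ([set: X] `*` D : set (eprod X X)) v p <->
  p.1 = v.1 /\ projection D v.2 p.2.
Proof.
have sqr_eprod (a : eprod X X) : `|a| ^+ 2 = `|a.1| ^+ 2 + `|a.2| ^+ 2.
  by rewrite -!dotpxx.
split=> [[[_ Dp] pmin]|[p1 [Dp pmin]]].
  have := pmin (v.1, p.2) (conj I Dp).
  rewrite -(@ler_pXn2r _ 2)// ?nnegrE// !sqr_eprod /=.
  rewrite subrr normr0 expr0n/= add0r gerDr => p10.
  have p1 : p.1 = v.1.
    apply/eqP; rewrite -subr_eq0 -normr_eq0 -sqrf_eq0.
    by rewrite eq_le p10 sqr_ge0.
  split=> //; split=> // z Dz; have := pmin (v.1, z) (conj I Dz).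
  rewrite -(@ler_pXn2r _ 2)// ?nnegrE// !sqr_eprod /=.
  by rewrite p1 subrr lerD2l ler_pXn2r// nnegrE.
split=> // z [_ Dz]; rewrite -(@ler_pXn2r _ 2)// ?nnegrE// !sqr_eprod /=.
rewrite p1 subrr normr0 expr0n/= add0r ler_wpDl ?sqr_ge0//.
by rewrite ler_pXn2r// ?nnegrE//; exact: pmin.
Qed.

(** By [projection_setTX] all the offsets [v - p] have first component [0], and
    this passes to the limit. *)
Lemma limiting_normal_cone_setTX X (D : set X) (w v : eprod X X) :
  limiting_normal_cone ([set: X] `*` D : set (eprod X X)) w v <->
  v.1 = 0 /\ limiting_normal_cone D w.2 v.2.
Proof.
split=> [[[_ Dw] [a [b [aw bv ab]]]]|[v1 [Dw [a [b [aw bv ab]]]]]].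
  have /eprod_cvgP[_ a2] := aw; have /eprod_cvgP[b1 b2] := bv.
  have abE k : (b k).1 = 0 /\
      cone [set (a k).2 - p | p in projection D (a k).2] (b k).2.
    have [t [_ [t0 [p /projection_setTX[p1 pP] <-] ->]]] := ab k.
    split; first by rewrite /= p1 subrr scaler0.
    by exists t, ((a k).2 - p.2); split=> //; exists p.2.
  split; last first.
    split=> //; exists (snd \o a), (snd \o b); split=> // k.
    exact: (abE k).2.
  have {}b1 : (fun=> 0 : X) @ \oo --> v.1.
    by move: b1; under eq_cvg do rewrite (abE _).1.
  by apply: (cvg_unique _ b1) => //; exact: cvg_cst.
split=> //; exists (fun k => (w.1, a k)), (fun k => (0, b k)); split.
- by apply/eprod_cvgP; split=> //; exact: cvg_cst.
- by apply/eprod_cvgP; rewrite v1; split=> //; exact: cvg_cst.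
- move=> k; have [t [_ [t0 [p pP <-] ->]]] := ab k.
  exists t, (0, a k - p); split=> //.
    exists (w.1, p); first exact/projection_setTX.
    by congr pair; rewrite subrr.
  by congr pair; rewrite scaler0.
Qed.

(** [y] remains a projection of every point of the segment from [y] to [x],
    so [x - y] is, up to a positive factor, the offset from its projection of a
    point arbitrarily close to [y]. *)
Lemma limiting_normal_cone_projection X (D : set X) (x y : X) (t : R) :
  0 <= t -> projection D x y -> limiting_normal_cone D y (t *: (x - y)).
Proof.
move=> t0 [Dy ymin]; split=> //.
exists (fun k => y + k.+1%:R^-1 *: (x - y)), (fun=> t *: (x - y)); split.
- rewrite -[X in _ --> X]addr0; apply: cvgD; first exact: cvg_cst.
  rewrite -(scale0r (x - y)); apply: cvgZr_tmp; exact: cvg_harmonic.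
- exact: cvg_cst.
- move=> k; set s : R := k.+1%:R^-1.
  have s0 : 0 < s by rewrite invr_gt0.
  have s1 : s <= 1 by rewrite invf_le1// ler1n.
  exists (t / s), (s *: (x - y)); split.
  + by rewrite divr_ge0// ltW.
  + exists y; last by rewrite addrC addKr.
    split=> // z Dz.
    rewrite [leLHS]distrC addrAC subrr add0r normrZ (gtr0_norm s0).
    have xE : z - x = z - (y + s *: (x - y)) - (1 - s) *: (x - y).
      rewrite -addrA -opprD -addrA -scalerDl addrCA subrr addr0 scale1r.
      by rewrite [y + _]addrC subrK.
    have := ymin z Dz.
    rewrite (distrC y x) xE => /le_trans /(_ (ler_normB _ _)).
    rewrite normrZ [`|1 - s|]ger0_norm ?subr_ge0// -lerBlDr; apply: le_trans.
    by rewrite mulrBl mul1r opprB addrCA subrr addr0.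
  + by rewrite scalerA divfK// gt_eqF.
Qed.

End NormalCones.

(** * The split problem *)

Section SplitProblem.
Context {R : realType} {X Y : euclideanType R}.
Variables (f : X -> R) (G : X -> Y) (C : set Y) (D : set X).
Implicit Types w : eprod X X.
Local Notation Q := (problemQ f G C D).

Lemma diff_constraintQ w (h : eprod X X) : differentiable G w.1 ->
  'd (constraint Q) w h = ('d G (w.1 : X) h.1, h.1 - h.2) :> eprod Y X.
Proof.
move=> dG; have [| |_ ->] // := @diff_of_remainder R (eprod X X) (eprod Y X)
  (constraint Q) (fun h => ('d G (w.1 : X) h.1, h.1 - h.2)) w.
  move=> a u v; congr pair; first by rewrite /= linearP.
  by rewrite /= scalerBr opprD addrACA.
move=> e e0.
have dGe := near0_fst (F := X) (diff_remainder dG e0); near=> k.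
apply: (le_trans (norm_eprod_le _)) => /=.
rewrite [X in _ + `|X|](_ : _ = 0); last first.
  have -> : w.1 + k.1 - (w.2 + k.2) = (w.1 - w.2) + (k.1 - k.2).
    by rewrite opprD addrACA.
  by rewrite -addrA -opprD subrr.
rewrite normr0 addr0; apply: (@le_trans _ _ (e * `|k.1|)); last first.
  by rewrite ler_wpM2l ?norm_fst_le// ltW.
by near: k.
Unshelve. all: by end_near. Qed.

Lemma gradient_objectiveQ w : differentiable f w.1 ->
  gradient (objective Q) w = (gradient f w.1, 0).
Proof.
move=> df; apply: eq_dotp => h; rewrite gradientP.
rewrite [RHS]/(eprod_dotp _ _) /eprod_dotp /= dotp0l addr0 gradientP.
have [| |_ ->] // := @diff_of_remainder R (eprod X X) R
  (objective Q) (fun h => 'd f (w.1 : X) h.1) w.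
  by move=> a u v; rewrite /= linearP.
move=> e e0.
have dfe := near0_fst (F := X) (diff_remainder df e0); near=> k.
apply: (@le_trans _ _ (e * `|k.1|)); last first.
  by rewrite ler_wpM2l ?norm_fst_le// ltW.
by near: k.
Unshelve. all: by end_near. Qed.

Lemma adjoint_constraintQ w (l : eprod Y X) : differentiable G w.1 ->
  adjoint ('d (constraint Q) w) l = (adjoint ('d G (w.1 : X)) l.1 + l.2, - l.2).
Proof.
move=> dG; apply: eq_dotp => h; rewrite adjointP diff_constraintQ//.
rewrite [LHS]/(eprod_dotp _ _) [RHS]/(eprod_dotp _ _) /eprod_dotp /=.
by rewrite dotpDl adjointP dotpNl dotpBr addrA.
Qed.

(** The second component of the stationarity equation identifies the multiplier
    of [x - y = 0] with the limiting normal to [D]; substituting it in the first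
    component leaves the stationarity equation of the original problem. *)
Lemma M_stationary_problemQ w : differentiable f w.1 -> differentiable G w.1 ->
  feasible Q w -> M_stationary Q w -> M_stationary (problemP f G C D) w.1.
Proof.
move=> df dG [[_ w12] _] [l lN [v /limiting_normal_cone_setTX[v1 vN]]].
move: lN; rewrite [constraint Q w]surjective_pairing w12.
move=> /normal_cone_setX0 lN.
rewrite gradient_objectiveQ// adjoint_constraintQ// => statQ.
have := congr1 fst statQ; have := congr1 snd statQ; rewrite /= v1 add0r addr0.
move=> /esym /eqP; rewrite addrC subr_eq0 => /eqP <- stat1.
exists l.1 => //; exists v.2; last by rewrite stat1 addrA.
by move: vN; move/eqP: w12; rewrite subr_eq0 => /eqP ->.
Qed.

(** Scaling the residuals [G x - p] and [x - y] by [tau] gives the multipliers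
    of the two constraints of the split problem, once its constraint is shifted
    by the residuals themselves: [p] is in [C], and the residual of [x - y = 0]
    becomes [0].  The components of the second variable cancel, and those of the
    first add up to the part of the gradient of the penalty function that does
    not come from [f]. *)
Lemma regularity_map_penalty tau x y p :
  differentiable f x -> differentiable G x -> closed C -> convex_set C ->
  0 < tau -> projection C (G x) p -> argmin D (penalty f G C tau x) y ->
  regularity_map Q (x, y) (G x - p, x - y)
    (gradient (fun u => penalty f G C tau u y) x - gradient f x, 0).
Proof.
move=> df dG clC cC tau0 pP [Dy ymin].
have yP : projection D x y.
  split=> // z Dz; have := ymin z Dz.
  rewrite lerD2l ler_pM2l ?divr_gt0// lerD2r.
  by rewrite ler_pXn2r ?nnegrE// !(distrC x).
exists (tau *: (G x - p), tau *: (x - y)).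
  rewrite (_ : constraint Q (x, y) - _ = (p, 0)); last first.
    by congr pair; [rewrite /= subKr|rewrite /= subrr].
  by apply/normal_cone_setX0; apply: normal_cone_projection => //; exact: ltW.
exists (0, tau *: (x - y)).
  apply/limiting_normal_cone_setTX; split=> //.
  by apply: limiting_normal_cone_projection => //; exact: ltW.
rewrite adjoint_constraintQ//= (gradient_penalty _ _ df dG clC cC pP).
congr pair; last by rewrite /= addNr.
by rewrite /= addr0 [RHS]addrC !addrA addNr add0r addrC.
Qed.

End SplitProblem.

(** * Passing to the limit *)

Section Limits.
Context {R : realType}.

Lemma cluster_subsequence (V : normedModType R) (u : nat -> V) l :
  cluster (u @ \oo) l ->
  exists2 k : nat -> nat, (forall n, (n < k n)%N) & u \o k @ \oo --> l.
Proof.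
move=> ul.
have /choice[k kP] : forall n, exists m, (n < m)%N /\ `|l - u m| <= n.+1%:R^-1.
  move=> n; have [||_ [[m nm <-] lm]] :=
      ul [set u m | m in [set m | (n < m)%N]] [set v | `|l - v| <= n.+1%:R^-1].
  - by exists n.+1 => // m nm; exists m.
  - move: (@cvg_id _ (nbhs l)) => /cvgrPdist_le; apply.
    by rewrite invr_gt0.
  by exists m.
exists k => [n|]; first exact: (kP n).1.
apply/subr_cvg0; apply: norm_cvg0.
apply: (@squeeze_cvgr _ _ _ _ (fun=> 0) (fun n => n.+1%:R^-1)).
- by near=> n; rewrite normr_ge0/= distrC (kP n).2.
- exact: cvg_cst.
- exact: cvg_harmonic.
Unshelve. all: by end_near. Qed.

(** Testing the derivative against the difference [d] of the two gradients
    bounds [`|d| ^+ 2] by [e * `|d|]. *)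
Lemma cvg_gradient (E : euclideanType R) (f : E -> R) (x : nat -> E) l :
  continuously_differentiable f -> x @ \oo --> l ->
  gradient f (x n) @[n --> \oo] --> gradient f l.
Proof.
move=> [_ cf] xl; apply/cvgrPdist_le => e e0.
have xf := xl _ (cf l e e0); near=> n.
have dn h : `|'d f (x n) h - 'd f l h| <= e * `|h| by move: h; near: n.
rewrite distrC; set d := _ - _.
have [->|d0] := eqVneq d 0; first by rewrite normr0 ltW.
rewrite -(@ler_pM2r _ `|d|) ?normr_gt0// -expr2 -dotpxx {1}/d dotpBl !gradientP.
by rewrite (le_trans (ler_norm _)).
Unshelve. all: by end_near. Qed.

End Limits.

Theorem theorem3p4 (R : realType) (X Y : euclideanType R)
    (f : X -> R) (G : X -> Y) (C : set Y) (D : set X)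
    (delta tau : nat -> R) (x y : nat -> X) (xbar ybar : X) :
  continuously_differentiable f ->
  continuously_differentiable G ->
  C !=set0 -> closed C -> convex_set C ->
  D !=set0 -> closed D ->
  penalty_decomposition_sequence f G C D delta tau x y ->
  delta @ \oo --> (0 : R) ->
  tau @ \oo --> +oo ->
  cluster ((fun k => (x k, y k) : eprod X X) @ \oo) (xbar, ybar) ->
  feasible (problemQ f G C D) (xbar, ybar) ->
  AM_regular (problemQ f G C D) (xbar, ybar) ->
  M_stationary (problemQ f G C D) (xbar, ybar) /\
  M_stationary (problemP f G C D) xbar.
Proof.
move=> cf cG C0 clC cC D0 clD [_ tau00 step] delta0 _ clu feas amr.
have [df dG] := (cf.1, cG.1).
have tau0 n : 0 < tau n.
  by elim: n => // n taun; have [_ _ _] := step n; exact: lt_trans.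
suff stat : M_stationary (problemQ f G C D) (xbar, ybar).
  split=> //; exact: (M_stationary_problemQ (w := (xbar, ybar))).
have [k nk /eprod_cvgP[/= xk yk]] := cluster_subsequence clu.
pose a n := x (k n); pose b n := y (k n).
have kE n : k n = (k n).-1.+1 by rewrite (ltn_predK (nk n)).
have km : (fun n => (k n).-1) @ \oo --> \oo.
  move=> A [N _ NA]; exists N => // n /= Nn; apply: NA => /=.
  by rewrite (leq_trans Nn)// -ltnS -kE nk.
have /choice[p pP] n : exists p, projection C (G (a n)) p.
  exact: projection_nonempty.
(* Iterate [k n] was computed with the parameters of index [(k n).-1]. *)
pose q n := gradient (fun u => penalty f G C (tau (k n).-1) u (b n)) (a n).
have q0 : q @ \oo --> 0.
  apply: norm_cvg0.
  apply: (@squeeze_cvgr _ _ _ _ (fun=> 0) (fun n => delta (k n).-1)).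
  - near=> n; rewrite normr_ge0/=.
    by have [+ _ _ _] := step (k n).-1; rewrite -kE.
  - exact: cvg_cst.
  - exact: cvg_comp km delta0.
have Ga : G (a n) @[n --> \oo] --> G xbar.
  apply: cvg_comp xk _; exact: differentiable_continuous.
have Gp : G (a n) - p n @[n --> \oo] --> 0.
  apply: norm_cvg0.
  apply: (@squeeze_cvgr _ _ _ _ (fun=> 0) (fun n => `|G xbar - G (a n)|)).
  - near=> n; rewrite normr_ge0/= distrC; apply: (pP n).2.
    exact: feas.1.1.
  - exact: cvg_cst.
  - rewrite -[X in _ --> X](normr0 Y) -(subrr (G xbar)).
    by apply: cvg_norm; apply: cvgB => //; exact: cvg_cst.
have := amr (- gradient f xbar, 0).
case.
  exists (fun n => (a n, b n)), (fun n => (G (a n) - p n, a n - b n)),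
    (fun n => (q n - gradient f (a n), 0)); split.
  - by apply/eprod_cvgP.
  - by move=> n; split=> //=; have [_ [+ _] _ _] := step (k n).-1; rewrite -kE.
  - apply/eprod_cvgP; split=> //=.
    by rewrite -[X in _ --> X]feas.1.2; exact: cvgB.
  - apply/eprod_cvgP; split=> /=; last exact: cvg_cst.
    by rewrite -sub0r; apply: cvgB => //; exact: cvg_gradient.
  - move=> n; apply: regularity_map_penalty => //.
    by have [_ + _ _] := step (k n).-1; rewrite -kE.
move=> l lN [v vN lv]; exists l; first by move: lN; rewrite subr0.
exists v => //; rewrite -addrA lv gradient_objectiveQ//.
by congr pair; rewrite /= ?subrr ?addr0.
Unshelve. all: by end_near. Qed.
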